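(* Let $\mathcal{A}$ be a finite connected poset. If $\mathcal{A}$ is acyclic, then for every finite connected poset $\mathcal{S}$ monotonicity equivalence holds for $(\mathcal{A},\mathcal{S})$.
   Context: All posets are finite. For a poset $\mathcal{S}$ with ground set $S$: $y$ covers $x$ if $x<y$ and no $z\in S$ satisfies $x<z<y$. The cover graph of $\mathcal{S}$ is the undirected graph on $S$ whose edges are the pairs $\{x,y\}$ such that one of $x,y$ covers the other. $\mathcal{S}$ is connected if its cover graph is connected, and acyclic if its cover graph contains no cycle (in the usual graph-theoretic sense). An up-set of $\mathcal{S}$ is a set $U\subseteq S$ such that $x\in U$ and $x\le y$ imply $y\in U$. For probability measures $P_1,P_2$ on $S$, write $P_1\preceq P_2$ if $P_1(U)\le P_2(U)$ for every up-set $U$ of $\mathcal{S}$. Let $\mathcal{A}$ (ground set $A$) and $\mathcal{S}$ (ground set $S$) be finite posets and let $(P_\alpha:\alpha\in A)$ be a system of probability measures on $S$. The system is stochastically monotone if $P_\alpha\preceq P_\beta$ whenever $\alpha\le\beta$ in $\mathcal{A}$. It is realizably monotone if there exist $S$-valued random variables $(\mathbf{X}_\alpha:\alpha\in A)$ on a common probability space such that $\mathbf{X}_\alpha\le\mathbf{X}_\beta$ in $\mathcal{S}$ whenever $\alpha\le\beta$ in $\mathcal{A}$, and $\mathbf{X}_\alpha$ has distribution $P_\alpha$ for every $\alpha\in A$. Monotonicity equivalence holds for $(\mathcal{A},\mathcal{S})$ if every stochastically monotone system $(P_\alpha:\alpha\in A)$ of probability measures on $S$ is realizably monotone. *)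

(* Defs.v *)
From HB Require Import structures.
From mathcomp Require Import all_boot all_order all_algebra.
From mathcomp Require Import all_classical all_reals all_analysis.

Set Implicit Arguments.
Unset Strict Implicit.
Unset Printing Implicit Defensive.

Import Order.TTheory.

Local Open Scope classical_set_scope.

Section CoverGraph.
Context {d : Order.disp_t} (T : finPOrderType d).

(* [covers x y] means that y covers x. *)
Definition covers (x y : T) : bool :=
  (x < y)%O && ~~ [exists z : T, (x < z)%O && (z < y)%O].

Definition cover_graph : rel T := fun x y => covers x y || covers y x.

Definition poset_connected : Prop := forall x y : T, connect cover_graph x y.

(* [ucycle] also holds for the empty sequence and for the back-and-forth walk
   [:: x; y] along a single edge; a cycle of a simple graph has at least three
   vertices. *)
Definition poset_acyclic : Prop :=
  forall c : seq T, ucycle cover_graph c -> size c <= 2.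

Definition up_set (U : set T) : Prop :=
  forall x y : T, U x -> (x <= y)%O -> U y.

End CoverGraph.

(* A finite set with the sigma-algebra of all its subsets. A [measurableType]
   is pointed, hence the base point s0; it plays no other role. *)
Definition discrete_space (S : finType) (s0 : S) : Type := S.

Section DiscreteSpace.
Context (S : finType) (s0 : S).

HB.instance Definition _ := Finite.copy (discrete_space s0) S.
HB.instance Definition _ := isPointed.Build (discrete_space s0) s0.
HB.instance Definition _ := @isMeasurable.Build default_measure_display
  (discrete_space s0) discrete_measurable discrete_measurable0
  discrete_measurableC discrete_measurableU.

End DiscreteSpace.

Section Monotonicity.
Context (R : realType) {dA dS : Order.disp_t}.
Context (A : finPOrderType dA) (S : finPOrderType dS).

Definition stoch_le (s0 : S) (P1 P2 : probability (discrete_space s0) R)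
    : Prop :=
  forall U : set S, up_set U -> (P1 U <= P2 U)%E.

Definition stochastically_monotone (s0 : S)
    (P : A -> probability (discrete_space s0) R) : Prop :=
  forall a b : A, (a <= b)%O -> stoch_le (P a) (P b).

Definition realizably_monotone (s0 : S)
    (P : A -> probability (discrete_space s0) R) : Prop :=
  exists (d : measure_display) (Omega : measurableType d)
         (Pr : probability Omega R) (X : A -> {RV Pr >-> discrete_space s0}),
    (forall a b : A, (a <= b)%O ->
       forall w : Omega, ((X a w : S) <= (X b w : S))%O) /\
    (forall a : A, distribution Pr (X a) =1 P a).

(* If S is empty then it carries no probability measure, so that quantifying
   over the base point does not weaken the definition. *)
Definition monotonicity_equivalence : Prop :=
  forall (s0 : S) (P : A -> probability (discrete_space s0) R),
    stochastically_monotone P -> realizably_monotone P.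

End Monotonicity.

(* Main.v *)
(** By a finite version of Strassen's theorem, [P_a <= P_b] gives a coupling
    supported on the order relation: move as much mass as possible along some
    pair [x <= y]; either a support shrinks or some up-set becomes tight, and
    then the problem splits into the tight up-set and its complement.
    Couplings along the edges of the cover graph, which is a tree, are glued
    as in a Markov chain indexed by that tree. *)

From HB Require Import structures.
Require Import Defs.
From mathcomp Require Import all_boot all_order all_algebra.

Set Implicit Arguments.
Unset Strict Implicit.
Unset Printing Implicit Defensive.

Import Order.TTheory GRing.Theory Num.Theory.

Local Open Scope ring_scope.

(** * Finite transport: Strassen's theorem on a finite poset *)

Section Transport.
Context (R : realFieldType) {d : Order.disp_t} (S : finPOrderType d).
Implicit Types (a b : S -> R) (U V : {set S}).

Definition is_up U := [forall x in U, forall y, (x <= y)%O ==> (y \in U)].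

(** The support lies in an arbitrary relation [r] rather than in the order, so that a coupling can
    also be read backwards. *)
Definition coupling a b (r : rel S) (Q : S -> S -> R) :=
  [/\ forall x y, 0 <= Q x y, forall x, \sum_y Q x y = a x,
      forall y, \sum_x Q x y = b y & forall x y, Q x y != 0 -> r x y].

(** Total masses agree but need not be 1, since the induction removes mass and cuts measures in
    two. *)
Definition dominated a b :=
  [/\ forall x, 0 <= a x, forall x, 0 <= b x, \sum_x a x = \sum_x b x
    & forall U, is_up U -> \sum_(x in U) a x <= \sum_(x in U) b x].

Lemma is_upP U : reflect (forall x y, x \in U -> (x <= y)%O -> y \in U) (is_up U).
Proof.
apply: (iffP forall_inP) => [h x y xU xy|h x xU].
  by move/forallP/(_ y): (h x xU); rewrite xy.
by apply/forallP => y; apply/implyP => /h; apply.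
Qed.

Lemma is_upU U V : is_up U -> is_up V -> is_up (U :|: V).
Proof.
move=> /is_upP hU /is_upP hV; apply/is_upP => x y; rewrite !inE.
by case/orP => [/hU h /h ->|/hV h /h ->]; rewrite ?orbT.
Qed.

Lemma is_upI U V : is_up U -> is_up V -> is_up (U :&: V).
Proof.
move=> /is_upP hU /is_upP hV; apply/is_upP => x y; rewrite !inE.
by case/andP => /hU h /hV h' xy; rewrite h // h'.
Qed.

Definition restr U a x : R := if x \in U then a x else 0.

Lemma sum_restr U V a :
  \sum_(x in V) restr U a x = \sum_(x in V :&: U) a x.
Proof.
rewrite -big_mkcondr; apply: eq_bigl => x; by rewrite inE.
Qed.

Lemma sum_restrT U a : \sum_x restr U a x = \sum_(x in U) a x.
Proof. by rewrite -big_mkcond. Qed.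

Lemma restr_ge0 U a : (forall x, 0 <= a x) -> forall x, 0 <= restr U a x.
Proof. by move=> a0 x; rewrite /restr; case: ifP. Qed.

(** [V :&: U] is again an up-set, so its inequality is already known; tightness of [U] equates the
    total masses. *)
Lemma dominated_restr U a b : is_up U -> dominated a b ->
  \sum_(x in U) a x = \sum_(x in U) b x -> dominated (restr U a) (restr U b).
Proof.
move=> upU [a0 b0 ab dom] tight; split; try exact: restr_ge0.
  by rewrite !sum_restrT.
by move=> V upV; rewrite !sum_restr dom ?is_upI.
Qed.

(** For [V :&: ~: U], which need not be an up-set, subtract the equality on [U] from the inequality
    on the up-set [V :|: U]. *)
Lemma dominated_restrC U a b : is_up U -> dominated a b ->
  \sum_(x in U) a x = \sum_(x in U) b x ->
  dominated (restr (~: U) a) (restr (~: U) b).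
Proof.
move=> upU [a0 b0 ab dom] tight; split; try exact: restr_ge0.
  rewrite !sum_restrT; move: ab.
  rewrite (bigID (mem U)) [RHS](bigID (mem U)) /= tight => /addrI.
  by under eq_bigl do rewrite -in_setC; under [RHS]eq_bigl do rewrite -in_setC.
move=> V upV; rewrite !sum_restr.
have e (c : S -> R) : \sum_(x in V :|: U) c x =
    \sum_(x in U) c x + \sum_(x in V :&: ~: U) c x.
  rewrite (big_setID U); congr (_ + _); apply: eq_bigl => x.
    by rewrite !inE; case: (x \in U); rewrite ?orbT ?andbF.
  by rewrite !inE; case: (x \in U); rewrite ?orbT ?orbF ?andbF ?andbT.
by have := dom _ (is_upU upV upU); rewrite !e tight lerD2l.
Qed.

Lemma coupling_split U a b r Q1 Q2 :
  coupling (restr U a) (restr U b) r Q1 ->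
  coupling (restr (~: U) a) (restr (~: U) b) r Q2 ->
  coupling a b r (fun x y => Q1 x y + Q2 x y).
Proof.
move=> [p1 row1 col1 s1] [p2 row2 col2 s2]; split.
- by move=> x y; rewrite addr_ge0.
- move=> x; rewrite big_split /= row1 row2 /restr inE.
  by case: ifP => _; rewrite ?addr0 ?add0r.
- move=> x; rewrite big_split /= col1 col2 /restr inE.
  by case: ifP => _; rewrite ?addr0 ?add0r.
- move=> x y; case: (eqVneq (Q1 x y) 0) => [->|/s1 //].
  by rewrite add0r => /s2.
Qed.

Definition take_at (x0 : S) (t : R) a x := a x - t *+ (x == x0).

Lemma sum_take_at (P : pred S) x0 t a :
  \sum_(x | P x) take_at x0 t a x = \sum_(x | P x) a x - t *+ P x0.
Proof.
rewrite sumrB; congr (_ - _); case: (boolP (P x0)) => Px0.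
  rewrite (bigD1 x0) //= eqxx big1 ?addr0 // => x /andP[_ /negPf ->].
  by [].
by rewrite big1 // => x Px; case: eqP => // xx0; rewrite -xx0 Px in Px0.
Qed.

(** Reverses the removal of mass [t] at [x0] and [y0] by sending that mass along the pair. *)
Lemma coupling_push x0 y0 t a b (r : rel S) Q : 0 <= t -> r x0 y0 ->
  coupling (take_at x0 t a) (take_at y0 t b) r Q ->
  coupling a b r (fun x y => Q x y + t *+ ((x == x0) && (y == y0))).
Proof.
move=> t0 r0 [p row col s]; split.
- by move=> x y; rewrite addr_ge0 // mulrn_wge0.
- move=> x; rewrite big_split /= row /take_at.
  rewrite (bigD1 y0) //= eqxx andbT big1 ?addr0 ?subrK // => y /negPf ->.
  by rewrite andbF.
- move=> y; rewrite big_split /= col /take_at.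
  rewrite (bigD1 x0) //= eqxx big1 ?addr0 ?subrK // => x /negPf ->.
  by [].
- move=> x y; case: (eqVneq (Q x y) 0) => [->|/s //].
  by rewrite add0r; case: andP => [[/eqP-> /eqP->]//|_]; rewrite eqxx.
Qed.

(** As [x0 <= y0], an up-set containing [x0] contains [y0]; only those containing [y0] but not [x0]
    lose slack. *)
Lemma dominated_push x0 y0 t a b : (x0 <= y0)%O -> t <= a x0 -> t <= b y0 ->
  0 <= t ->
  (forall U, is_up U -> y0 \in U -> x0 \notin U ->
    t <= \sum_(x in U) b x - \sum_(x in U) a x) ->
  dominated a b -> dominated (take_at x0 t a) (take_at y0 t b).
Proof.
move=> xy ta tb t0 slack [a0 b0 ab dom]; split.
- by move=> x; rewrite /take_at; case: eqP => [->|]; rewrite ?subr_ge0 ?subr0.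
- by move=> x; rewrite /take_at; case: eqP => [->|]; rewrite ?subr_ge0 ?subr0.
- by rewrite !sum_take_at ab.
- move=> U upU; rewrite !sum_take_at.
  case: (boolP (y0 \in U)) => yU; case: (boolP (x0 \in U)) => xU.
  + by rewrite lerD2r dom.
  + by rewrite subr0 lerBrDr addrC -lerBrDr slack.
  + by move/is_upP: upU => /(_ _ _ xU xy); rewrite (negPf yU).
  + by rewrite !subr0 dom.
Qed.

Definition supp a := [set x | a x != 0].

Lemma supp_restr U a : supp (restr U a) \subset supp a.
Proof. by apply/subsetP => x; rewrite !inE /restr; case: ifP; rewrite ?eqxx. Qed.

Lemma supp_take_at x0 t a : a x0 != 0 -> supp (take_at x0 t a) \subset supp a.
Proof.
move=> h; apply/subsetP => x; rewrite !inE /take_at.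
by case: (eqVneq x x0) => [->|]; rewrite ?subr0.
Qed.

Lemma supp_ltn a c x : supp a \subset supp c -> c x != 0 -> a x = 0 ->
  (#|supp a| < #|supp c|)%N.
Proof.
move=> sub cx ax; apply: proper_card; rewrite properE sub.
by apply/subsetPn; exists x; rewrite inE ?ax ?eqxx.
Qed.

(** Induction on the total size of the two supports. Every recursive call loses a point of one of
    them: a point emptied by the push, or [x0] or [y0] left out of its half of a split. *)
Lemma dominated_coupling a b : dominated a b ->
  exists Q, coupling a b (fun x y => (x <= y)%O) Q.
Proof.
have [n] := ubnP (#|supp a| + #|supp b|).
elim: n a b => // n IH a b le_n dom.
have [a0 b0 ab domU] := dom.
case: (pickP [pred x | a x != 0]) => [x0 /= ax0|a_eq0]; last first.
  have az x : a x = 0 by apply/eqP; move/negbFE: (a_eq0 x).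
  have bz x : b x = 0.
    apply/eqP; move: ab; rewrite big1 => [/esym/eqP|//].
    by rewrite psumr_eq0 // => /allP/(_ x); rewrite mem_index_enum => /(_ isT).
  exists (fun _ _ => 0); split => // [x|x|x y].
  - by rewrite az big1.
  - by rewrite bz big1.
  - by rewrite eqxx.
(* Domination on the principal up-set of [x0] forces [b] to have mass there. *)
have [y0 xy by0] : exists2 y0, (x0 <= y0)%O & b y0 != 0.
  have upx : is_up [set y | (x0 <= y)%O].
    by apply/is_upP => x y; rewrite !inE; apply: le_trans.
  have ax_gt0 : 0 < a x0 by rewrite lt0r ax0 a0.
  have : 0 < \sum_(x in [set y | (x0 <= y)%O]) b x.
    apply: lt_le_trans (domU _ upx).
    rewrite (bigD1 x0) ?inE //=; apply: ltr_pwDl => //.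
    by rewrite sumr_ge0.
  rewrite lt0r => /andP[/eqP nz _].
  case: (pickP [pred y | (x0 <= y)%O && (b y != 0)]) => [y /andP[]|none].
    by exists y.
  case: nz; apply: big1 => y; rewrite inE => xy.
  by apply/eqP; move: (none y); rewrite /= xy => /negbFE.
pose m := Num.min (a x0) (b y0).
have m_a : m <= a x0 by rewrite /m ge_min lexx.
have m_b : m <= b y0 by rewrite /m ge_min lexx orbT.
have m0 : 0 <= m by rewrite le_min a0 b0.
pose gap U := \sum_(x in U) b x - \sum_(x in U) a x.
(* These are the up-sets that prevent moving all of [m]. *)
pose bad U := [&& is_up U, y0 \in U, x0 \notin U & gap U < m].
case: (pickP bad) => [U0 bad0|no_bad]; last first.
  have slack U : is_up U -> y0 \in U -> x0 \notin U -> m <= gap U.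
    move=> upU yU xU; move/negbT: (no_bad U).
    by rewrite /bad upU yU xU -leNgt.
  have [] := IH (take_at x0 m a) (take_at y0 m b); last first.
  - by move=> Q /(coupling_push m0 xy) cQ; eexists; exact: cQ.
  - exact: dominated_push.
  rewrite -ltnS; apply: leq_trans le_n; rewrite ltnS.
  have sa := supp_take_at m ax0; have sb := supp_take_at m by0.
  have [mE|mE] : m = a x0 \/ m = b y0.
    by rewrite /m; case: leP; [left|right].
  - rewrite -addSn leq_add ?subset_leq_card //.
    by apply: (supp_ltn sa ax0); rewrite /take_at eqxx mE subrr.
  - rewrite -addnS leq_add ?subset_leq_card //.
    by apply: (supp_ltn sb by0); rewrite /take_at eqxx mE subrr.
(* Moving exactly the least slack of an obstructing up-set keeps domination and makes [U] tight. *)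
case: (@arg_minP _ _ _ U0 bad gap bad0) => U /and4P[upU yU xU lt_m] minU.
set t := gap U in lt_m minU.
(* If such a [V] is not [bad], its gap is at least [m], hence more than [t]. *)
have slack V : is_up V -> y0 \in V -> x0 \notin V -> t <= gap V.
  move=> upV yV xV; case: (ltP (gap V) m) => [h|]; last exact/le_trans/ltW.
  by apply: minU; rewrite /bad upV yV xV h.
have t0 : 0 <= t by rewrite subr_ge0 domU.
have ta : t <= a x0 := le_trans (ltW lt_m) m_a.
have tb : t <= b y0 := le_trans (ltW lt_m) m_b.
have dom' := dominated_push xy ta tb t0 slack dom.
have tight : \sum_(x in U) take_at x0 t a x = \sum_(x in U) take_at y0 t b x.
  by rewrite !sum_take_at yU (negPf xU) subr0 /t /gap subKr.
have sa V := subset_trans (supp_restr V _) (supp_take_at t ax0).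
have sb V := subset_trans (supp_restr V _) (supp_take_at t by0).
(* [x0] lies outside [U], so the first support loses it. *)
have [|Q1 c1] := IH _ _ _ (dominated_restr upU dom' tight).
  rewrite -ltnS; apply: leq_trans le_n; rewrite ltnS -addSn.
  rewrite leq_add ?subset_leq_card //.
  by apply: (supp_ltn (sa U) ax0); rewrite /restr (negPf xU).
(* [y0] lies in [U], so on the complement the second support loses it. *)
have [|Q2 c2] := IH _ _ _ (dominated_restrC upU dom' tight).
  rewrite -ltnS; apply: leq_trans le_n; rewrite ltnS -addnS.
  rewrite leq_add ?subset_leq_card //.
  by apply: (supp_ltn (sb _) by0); rewrite /restr inE yU.
by eexists; exact: coupling_push t0 xy (coupling_split c1 c2).
Qed.

End Transport.

(** * The cover graph: monotonicity along covers and induction over a tree *)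

Section CoverTree.
Context {d : Order.disp_t} (A : finPOrderType d).
Implicit Types (B : {set A}) (a b c : A).

(** Induction on the number of elements strictly between [a] and [b]: an intermediate [z] splits the
    interval into two that both omit [z]. *)
Lemma covers_homo (d' : Order.disp_t) (T : porderType d') (f : A -> T) :
  (forall a b, covers a b -> f a <= f b)%O -> forall a b, (a <= b)%O -> (f a <= f b)%O.
Proof.
move=> fc a b.
have [n] := ubnP #|[set z | (a < z)%O && (z < b)%O]|.
elim: n a b => // n IH a b; rewrite ltnS => le_n; rewrite (le_eqVlt a) => /orP[/eqP->//|ab].
case: (boolP (covers a b)) => [/fc//|]; rewrite /covers ab negbK.
case/existsP => z /andP[az zb].
apply: (@le_trans _ _ (f z)); apply: IH; rewrite ?ltW //.
- apply: leq_trans (proper_card _) le_n; apply/properP; split.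
    by apply/subsetP => y; rewrite !inE => /andP[-> /lt_trans]; apply.
  by exists z; rewrite !inE ?az ?zb ?ltxx ?andbF.
- apply: leq_trans (proper_card _) le_n; apply/properP; split.
    by apply/subsetP => y; rewrite !inE => /andP[zy ->]; rewrite (lt_trans az).
  by exists z; rewrite !inE ?az ?zb ?ltxx.
Qed.

(** Both ends must lie in [B], so that connecting paths avoid vertices outside [B]. *)
Definition edge_in B : rel A :=
  fun x y => [&& x \in B, y \in B & cover_graph x y].

Definition connected_in B := forall x y, x \in B -> y \in B -> connect (edge_in B) x y.

Lemma cover_graph_sym a b : cover_graph a b = cover_graph b a.
Proof. by rewrite /cover_graph orbC. Qed.

Lemma connected_in1 a : connected_in [set a].
Proof. by move=> x y; rewrite !inE => /eqP-> /eqP->. Qed.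

Lemma connected_inU1 B a b : connected_in B -> b \in B -> cover_graph a b ->
  connected_in (a |: B).
Proof.
move=> conB bB ab.
have sub x y : x \in B -> y \in B -> connect (edge_in (a |: B)) x y.
  move=> xB yB; apply: connect_sub (conB _ _ xB yB) => {x y xB yB} x y.
  by case/and3P => xB yB xy; apply: connect1; rewrite /edge_in !inE xB yB xy !orbT.
have e1 : edge_in (a |: B) a b by rewrite /edge_in !inE eqxx bB orbT ab.
have e2 : edge_in (a |: B) b a by rewrite /edge_in !inE eqxx bB orbT cover_graph_sym ab.
move=> x y; rewrite !inE => /orP[/eqP->|xB] /orP[/eqP->|yB] //.
- exact: connect_trans (connect1 e1) (sub _ _ bB yB).
- exact: connect_trans (sub _ _ xB bB) (connect1 e2).
- exact: sub.
Qed.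

Lemma edge_in_path B x p : x \in B -> path (edge_in B) x p ->
  path (@cover_graph _ A) x p && all [in B] p.
Proof.
elim: p x => //= y p IH x xB /andP[/and3P[_ yB ->] /IH-/(_ yB)/andP[-> ->]].
by rewrite yB.
Qed.

(** Two distinct neighbours of [a] in [B] are joined by a simple path inside [B]; closing it through
    [a], which lies outside, gives a cycle on at least three vertices. *)
Lemma acyclic_neighbor_uniq B a b c : poset_acyclic A -> connected_in B ->
  a \notin B -> b \in B -> c \in B -> cover_graph a b -> cover_graph a c -> b = c.
Proof.
move=> acyc conB aB bB cB ab ac; apply/eqP/negPn/negP => bc.
have /connectP[p0 pth0 E0] := conB _ _ bB cB.
case/shortenP: pth0 E0 => p pth up _ Ec.
have /andP[pthG /allP pB] := edge_in_path bB pth.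
have := acyc (a :: b :: p); rewrite /ucycle /= ab rcons_path pthG -Ec.
rewrite cover_graph_sym ac /=.
have -> : a \notin b :: p.
  by apply/negP; rewrite inE => /orP[/eqP E|/pB]; rewrite ?E ?(negPf aB) // -E (negPf aB) in bB *.
rewrite -/(uniq (b :: p)) in up *; rewrite up => /(_ isT).
(* The bound on the cycle length leaves [p] empty, which makes [c] equal to [b]. *)
by case: p Ec {pth up pthG pB} => //= E; rewrite E eqxx in bc.
Qed.

(** Otherwise [B] is closed under adjacency, and connectedness makes it the whole of [A]. *)
Lemma connected_neighbor B a0 : poset_connected A -> a0 \in B -> B != [set: A] ->
  exists a b, [/\ a \notin B, b \in B & cover_graph a b].
Proof.
move=> con a0B nT.
case: (pickP [pred u : A * A | [&& u.1 \notin B, u.2 \in B & cover_graph u.1 u.2]]).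
  by case=> a b /and3P[]; exists a, b.
move=> none; case/negP: nT; rewrite -subTset; apply/subsetP => x _.
have clB : closed (@cover_graph _ A) [in B].
  apply: intro_closed; first exact/sym_connect_sym/cover_graph_sym.
  move=> u v uv uB; apply: contraT => vB.
  by have := none (v, u); rewrite /= vB cover_graph_sym uv (uB : u \in B).
by have := closed_connect clB (con a0 x); rewrite [in LHS]a0B.
Qed.

(* Acyclicity makes the old neighbour [b] of the new vertex [a] unique. *)
Lemma tree_ind (P : {set A} -> Prop) a0 :
  poset_connected A -> poset_acyclic A -> P [set a0] ->
  (forall B a b, P B -> a \notin B -> b \in B -> cover_graph a b ->
     (forall c, c \in B -> cover_graph a c -> c = b) -> P (a |: B)) ->
  P [set: A].
Proof.
move=> con acyc P0 step.
(* The induction is on the number of vertices missing from [B]; connectedness of [B] is carried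
   along for the uniqueness of the neighbour. *)
suff H n B : a0 \in B -> connected_in B -> P B -> (#|~: B| <= n)%N -> P [set: A].
  by apply: (H _ [set a0]); rewrite ?set11 //; exact: connected_in1.
elim: n B => [|n IH] B a0B conB PB.
  rewrite leqn0 cards_eq0 => /eqP/(congr1 (@setC _)).
  by rewrite setCK setC0 => <-.
move=> le_n; case: (eqVneq B [set: A]) => [<-//|nT].
have [a [b [aB bB ab]]] := connected_neighbor con a0B nT.
apply: (IH (a |: B)).
- by rewrite inE a0B orbT.
- exact: connected_inU1 ab.
- apply: (step B a b) => // c cB ac.
  exact: (acyclic_neighbor_uniq acyc conB aB cB bB ac ab).
- rewrite -ltnS; apply: leq_trans le_n; apply: proper_card; apply/properP.
  split; first by rewrite setCS subsetUr.
  by exists a; rewrite !inE ?eqxx.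
Qed.

End CoverTree.

(** * Gluing couplings along the tree *)

Section Gluing.
Context (R : realFieldType) {dA dS : Order.disp_t}.
Context (A : finPOrderType dA) (S : finPOrderType dS).
Implicit Types (p : A -> S -> R) (B : {set A}).

(** A finite weighted sample space. Order is asked along covers only, and only off the null points;
    both restrictions are lifted once [B] is all of [A]. *)
Definition finitely_realized p B := exists (W : finType) (q : W -> R) (X : A -> W -> S),
  [/\ forall w, 0 <= q w, \sum_w q w = 1,
      forall a, a \in B -> forall s, \sum_(w | X a w == s) q w = p a s
    & forall a b, a \in B -> b \in B -> covers a b ->
        forall w, q w != 0 -> (X a w <= X b w)%O].

Lemma finitely_realized1 p a0 : (forall s, 0 <= p a0 s) -> \sum_s p a0 s = 1 ->
  finitely_realized p [set a0].
Proof.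
move=> p0 p1; exists S, (p a0), (fun _ s => s); split => // a.
by rewrite inE => /eqP-> s; rewrite big_pred1_eq.
Qed.

(* The old variables are kept and, given [w], the new one is drawn from the
   conditional law [Q (X b w) s / p b (X b w)]; where the denominator vanishes
   the quotient is [0], but then so is [q w]. *)
Lemma finitely_realized_glue p B a b (r : rel S) Q :
  finitely_realized p B -> a \notin B -> b \in B ->
  coupling (p b) (p a) r Q ->
  (forall c, c \in B -> cover_graph a c -> c = b) ->
  (covers b a -> forall s t, r s t -> (s <= t)%O) ->
  (covers a b -> forall s t, r s t -> (t <= s)%O) ->
  finitely_realized p (a |: B).
Proof.
move=> [W [q [X [q0 q1 mX ordX]]]] aB bB [Q0 row col suppQ] nb up down.
pose K x s := Q x s / p b x.
have pb0 x : 0 <= p b x by rewrite -row sumr_ge0.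
(* [w] itself belongs to the fibre of [X b] whose weights add up to [p b (X b w)]. *)
have q_le w : q w <= p b (X b w).
  by rewrite -(mX _ bB) (bigD1 w) //= ler_wpDr // sumr_ge0.
have sumK w : \sum_s q w * K (X b w) s = q w.
  rewrite -mulr_sumr -mulr_suml row.
  case: (eqVneq (p b (X b w)) 0) => [z|nz]; last by rewrite divff ?mulr1.
  have /eqP-> : q w == 0 by rewrite eq_le q0 -z q_le.
  by rewrite mul0r.
(* If [p b x] vanishes, so does the whole row of [Q] at [x], being nonnegative with sum zero. *)
have pK x s : p b x * K x s = Q x s.
  case: (eqVneq (p b x) 0) => [z|nz]; last by rewrite mulrC divfK.
  rewrite z mul0r; apply/esym/eqP; rewrite eq_le Q0 andbT -z -row.
  by rewrite (bigD1 s) //= ler_wpDr // sumr_ge0.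
exists (W * S)%type, (fun u => q u.1 * K (X b u.1) u.2),
  (fun c u => if c == a then u.2 else X c u.1); split.
- by move=> [w s]; rewrite mulr_ge0 // divr_ge0.
- rewrite -q1 -(pair_big xpredT xpredT (fun w t => q w * K (X b w) t)) /=.
  by apply: eq_bigr => w _; exact: sumK.
(* For the new variable, group by the value of [X b]: each fibre contributes one entry of a column
   of [Q]. For an old variable, sum out the second coordinate. *)
- move=> c; rewrite !inE => /orP[/eqP->|cB] s.
    rewrite eqxx -col.
    rewrite (eq_bigl (fun u : W * S => true && (u.2 == s))) //.
    rewrite -(pair_big xpredT (pred1 s) (fun w t => q w * K (X b w) t)) /=.
    under eq_bigr do rewrite big_pred1_eq.
    rewrite (partition_big (X b) xpredT) //=; apply: eq_bigr => x _.
    rewrite -pK -(mX _ bB) mulr_suml.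
    by apply: eq_bigr => w /eqP->.
  have /negPf-> : c != a by apply: contraNneq aB => <-.
  rewrite -(mX _ cB) (eq_bigl (fun u : W * S => (X c u.1 == s) && true)).
    rewrite -(pair_big (fun w => X c w == s) xpredT (fun w t => q w * K (X b w) t)) /=.
    by apply: eq_bigr => w _; exact: sumK.
  by move=> u; rewrite andbT.
(* A nonzero weight gives both [q w != 0] and [Q (X b w) s != 0]; by [nb], a new cover can only join
   [a] and [b]. *)
move=> c e; rewrite !inE => cB eB ce [w s] /=; rewrite mulf_eq0 negb_or /K.
rewrite mulf_eq0 negb_or => /and3P[qw /suppQ rQ _].
have irr x : covers x x = false by rewrite /covers ltxx.
move: cB eB ce.
case: (eqVneq c a) => [->|_] /= cB; case: (eqVneq e a) => [->|_] /= eB ce.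
- by rewrite irr in ce.
- have eb : e = b by apply: nb => //; rewrite /cover_graph ce.
  by rewrite eb in ce *; exact: down rQ.
- have cb : c = b by apply: nb => //; rewrite /cover_graph ce orbT.
  by rewrite cb in ce *; exact: up rQ.
- exact: ordX ce _ qw.
Qed.

Lemma coupling_tr (T : finPOrderType dS) (a b : T -> R) r Q :
  coupling a b r Q -> coupling b a (fun x y => r y x) (fun x y => Q y x).
Proof. by case=> Q0 row col s; split => // x y; exact: s. Qed.

Lemma finitely_realizedT p : poset_connected A -> poset_acyclic A ->
  (forall a b, (a <= b)%O -> dominated (p a) (p b)) ->
  (forall a, \sum_s p a s = 1) -> S -> finitely_realized p [set: A].
Proof.
move=> con acyc dom p1 s0.
(* With no index at all, a one-point sample space serves. *)
case: (pickP (@predT A)) => [a0 _|noA]; last first.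
  exists unit, (fun=> 1), (fun _ _ => s0); split=> // [|a]; last by have := noA a.
  by rewrite big_const card_unit /= addr0.
have p0 a s : 0 <= p a s by have [] := dom a a (lexx a).
apply: (tree_ind con acyc (finitely_realized1 (p0 a0) (p1 a0))) => B a b fB aB bB ab nb.
have lt_cov (x y : A) : covers x y -> (x < y)%O by case/andP.
(* The coupling runs from the lower to the upper vertex, so it is transposed when the new vertex [a]
   is the lower one. *)
case/orP: (ab) => /lt_cov lt_ab.
- have [Q cQ] := dominated_coupling (dom _ _ (ltW lt_ab)).
  apply: (finitely_realized_glue fB aB bB (coupling_tr cQ) nb) => //.
  by move/lt_cov/lt_trans/(_ lt_ab); rewrite ltxx.
- have [Q cQ] := dominated_coupling (dom _ _ (ltW lt_ab)).
  apply: (finitely_realized_glue fB aB bB cQ nb) => //.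
  by move/lt_cov/lt_trans/(_ lt_ab); rewrite ltxx.
Qed.

End Gluing.

From mathcomp Require Import all_classical all_reals all_analysis.

Local Open Scope classical_set_scope.

(** * Probability measures and random variables on finite discrete spaces *)

Section DiscreteProbability.
Context (R : realType).

(** Additivity over the finitely many singletons of [U]; [fine] is faithful because probabilities
    are finite. *)
Lemma discrete_probE (S : finType) (s0 : S) (P : probability (discrete_space s0) R)
    (U : set S) :
  P U = (\sum_(x | x \in U) fine (P [set x]))%:E.
Proof.
have -> : P U = (\sum_(x \in U) P [set x])%E.
  rewrite -(measure_fin_bigcup P) //; first by rewrite bigcup_imset1 image_id.
  - exact: (@finite_finset S).
  - by move=> x y _ _ [z [/= -> ->]].
rewrite -sumEFin -[in LHS](set_mem_set U) -(bigfs _ (index_enum_uniq _)).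
  by apply: eq_bigr => x _; rewrite fineK // fin_num_measure.
by move=> x _; rewrite mem_index_enum.
Qed.

(** The measure is a sum of Dirac masses weighted by [q], one for each entry of the enumeration of
    [W]. *)
Lemma discrete_prob_exists (W : finType) (w0 : W) (q : W -> R) :
  (forall w, 0 <= q w) -> \sum_w q w = 1 ->
  exists Pr : probability (discrete_space w0) R,
    forall U : set W, Pr U = (\sum_(w | w \in U) q w)%:E.
Proof.
move=> q0 q1.
(* [msum] takes measures indexed by [nat]; the default [w0] is not reached below the size of the
   enumeration. *)
pose e (n : nat) : discrete_space w0 := nth w0 (index_enum W) n.
pose mu : {measure set (discrete_space w0) -> \bar R} :=
  msum (fun n => mscale (NngNum (q0 (e n))) (dirac (e n))) (size (index_enum W)).
have muE (U : set W) : mu U = (\sum_(w | w \in U) q w)%:E.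
  rewrite /mu /= /msum /mscale /= -sumEFin [RHS]big_mkcond /= [RHS](big_nth w0).
  rewrite big_mkord; apply: eq_bigr => i _; rewrite /mscale /= /dirac indicE.
  by case: ifP => _; rewrite ?mule1 ?mule0.
have mu1 : mu setT = 1%E.
  rewrite muE -[1%E]/(1%:E) -q1; congr (_%:E); apply: eq_bigl => w.
  by rewrite in_setT.
pose Pr : probability (discrete_space w0) R :=
  HB.pack (Measure.sort mu) (Measure_isProbability.Build _ _ _ mu mu1).
by exists Pr => U; rewrite -muE.
Qed.

Lemma discrete_rv (d : measure_display) (T : measurableType d)
    (W : finType) (w0 : W) (Pr : probability (discrete_space w0) R) (f : W -> T) :
  exists X : {RV Pr >-> T}, X =1 f.
Proof.
have mf : measurable_fun [set: discrete_space w0] f by [].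
pose X : {mfun discrete_space w0 >-> T} :=
  HB.pack (f : discrete_space w0 -> T) (isMeasurableFun.Build _ _ _ _ _ mf).
by exists X.
Qed.

End DiscreteProbability.

(** * From finite realizations to realizable monotonicity *)

Section Realization.
Context (R : realType) {dA dS : Order.disp_t}.
Context (A : finPOrderType dA) (S : finPOrderType dS) (s0 : S).

Definition mass (P : probability (discrete_space s0) R) (s : S) : R := fine (P [set s]).

Lemma mass_sum1 P : \sum_s mass P s = 1.
Proof.
apply: EFin_inj; rewrite -(probability_setT P) (discrete_probE P setT).
by congr (_%:E); apply: eq_bigl => x; rewrite in_setT.
Qed.

Lemma stoch_le_dominated (P1 P2 : probability (discrete_space s0) R) :
  stoch_le P1 P2 -> dominated (mass P1) (mass P2).
Proof.
have mass0 P x : 0 <= mass P x by rewrite fine_ge0.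
have massE P (U : {set S}) : (\sum_(x in U) mass P x)%:E = P [set` U].
  rewrite discrete_probE; congr (_%:E); apply: eq_bigl => x.
  by rewrite mem_setE.
move=> le12; split => // [|U /is_upP upU]; first by rewrite !mass_sum1.
by rewrite -lee_fin !massE; apply: le12 => x y; exact: upU.
Qed.

(** Order along covers extends to all comparable pairs, and order off the null points becomes order
    everywhere. *)
Lemma realizably_monotone_finite (P : A -> probability (discrete_space s0) R) :
  finitely_realized (fun a => mass (P a)) [set: A]%SET -> realizably_monotone P.
Proof.
move=> [W [q [X [q0 q1 mX ordX]]]].
(* The weights sum to 1, so [W] has a point, which serves as base point. *)
have [w0 _|noW] := pickP (@predT W); last first.
  by move: q1; rewrite big_pred0 // => /eqP; rewrite eq_sym oner_eq0.
have [Pr PrE] := discrete_prob_exists w0 q0 q1.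
(* At null points all variables take the same value [s0]: the order then holds there too, and the
   laws do not change. *)
pose f a w : S := if q w == 0 then s0 else X a w.
(* [cid] chooses, for each [a], a random variable that agrees with [f a] everywhere. *)
pose Y a := sval (cid (discrete_rv Pr (f a : W -> discrete_space s0))).
have YE a : Y a =1 f a := svalP (cid (discrete_rv Pr (f a : W -> discrete_space s0))).
exists _, (discrete_space w0), Pr, Y; split => [a b ab w|a U].
  rewrite !YE /f; case: eqVneq => // qw.
  apply: (covers_homo (f := X ^~ w)) ab => c e ce.
  by apply: ordX; rewrite ?inE.
rewrite /distribution /pushforward PrE discrete_probE; congr (_%:E).
transitivity (\sum_(w | X a w \in U) q w).
  rewrite big_mkcond [RHS]big_mkcond; apply: eq_bigr => w _.
  have -> : (w \in Y a @^-1` U) = (f a w \in U).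
    by apply/idP/idP; rewrite !inE /= YE.
  by rewrite /f; case: eqVneq => // ->; rewrite !if_same.
rewrite (partition_big (X a) [in U]) //=; apply: eq_bigr => s sU.
rewrite -/(mass (P a) s) -(mX a) ?inE //; apply: eq_bigl => w.
by case: eqP => [->|]; rewrite ?sU ?andbF.
Qed.

End Realization.

Theorem theorem4p1 (R : realType) (dA : Order.disp_t) (A : finPOrderType dA)
    (hconn : poset_connected A) (hacyc : poset_acyclic A) :
  forall (dS : Order.disp_t) (S : finPOrderType dS),
    poset_connected S -> monotonicity_equivalence R A S.
Proof.
move=> dS S _ s0 P monP; apply: realizably_monotone_finite.
apply: finitely_realizedT => // [a b /monP/stoch_le_dominated//|a].
exact: mass_sum1.
Qed.
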